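(* Let $R_i(x;\alpha,\beta,\gamma,\delta,N,z)=R^{(G)}_i(x;\alpha,\beta,\gamma,\delta,N,z)$ be the (not necessarily balanced) terminating ${}_4\phi_3$ functions. The following relations hold. (GI) $\displaystyle R_i(x;\alpha,\beta,\gamma,\delta,N,z)=\frac{(1-\alpha\beta q^{i+1})(q^i-q^N)}{(1-q^N)(1-\alpha\beta q^{2i+1})}R_i(x;\alpha,\beta q,\gamma/q,\delta,N-1,z)+\frac{(1-\alpha\beta q^{N+i+1})(1-q^i)}{(1-q^N)(1-\alpha\beta q^{2i+1})}R_{i-1}(x;\alpha,\beta q,\gamma/q,\delta,N-1,z).$ (GII) $\displaystyle R_i(x;\alpha,\beta,\gamma,\delta,N,z)=\frac{(1-\delta q^i)(1-\alpha\beta q^{i+1})}{(1-\delta)(1-\alpha\beta q^{2i+1})}R_i(x;\alpha,\beta q,\gamma,\delta q,N,z)-\frac{(1-q^i)(\delta-\alpha\beta q^{i+1})}{(1-\delta)(1-\alpha\beta q^{2i+1})}R_{i-1}(x;\alpha,\beta q,\gamma,\delta q,N,z).$ (GIII) $\displaystyle (1-q^{-x})(1-\gamma q^{x-N})R_i(x-1;\alpha q,\beta,\gamma q,\delta q,N-1,z)=\frac{q^{i-N+1}(1-\alpha q)(1-\delta)(1-q^N)}{z(1-\alpha\beta q^{2i+2})}\Big(R_{i+1}(x;\alpha,\beta,\gamma,\delta,N,z)-R_i(x;\alpha,\beta,\gamma,\delta,N,z)\Big).$ (GIV) $\displaystyle R_i(x;\alpha,\beta,\gamma,\delta,N,z)=\frac{(1-\alpha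 q^{i+1})(1-\alpha\beta q^{i+1})}{(1-\alpha q)(1-\alpha\beta q^{2i+1})}R_i(x;\alpha q,\beta,\gamma,\delta,N,z)-\frac{\alpha q(1-\beta q^i)(1-q^i)}{(1-\alpha q)(1-\alpha\beta q^{2i+1})}R_{i-1}(x;\alpha q,\beta,\gamma,\delta,N,z).$ (GV) $\displaystyle R_i(x;\alpha,\beta,\gamma,\delta,N,z)=\frac{1-\alpha\beta q^{i+1}}{1-\alpha\beta q^{2i+1}}R_i(x;\alpha,\beta q,\gamma,\delta,N,z)+\frac{\alpha\beta q^{i+1}(1-q^i)}{1-\alpha\beta q^{2i+1}}R_{i-1}(x;\alpha,\beta q,\gamma,\delta,N,z).$ (GVI) $\displaystyle R_i(x;\alpha,\beta,\gamma,\delta,N,z)=\frac{q^i(1-\alpha\beta q^{i+1})}{1-\alpha\beta q^{2i+1}}R_i(x;\alpha,\beta q,\gamma,\delta,N,z/q)+\frac{1-q^i}{1-\alpha\beta q^{2i+1}}R_{i-1}(x;\alpha,\beta q,\gamma,\delta,N,z/q).$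
   Context: For parameters $\alpha,\beta,\gamma,\delta,z,q$ and $N$ a non-negative integer, $$R^{(G)}_i(x;\alpha,\beta,\gamma,\delta,N,z)={}_4\phi_3\left({q^{-i},\ \alpha\beta q^{i+1},\ q^{-x},\ \gamma q^{x-N}\atop \alpha q,\ \delta,\ q^{-N}}\Big|\,q;z\right),$$ where for $i=0,1,2,\dots$, ${}_{p+1}\phi_p\big({q^{-i},a_1,\dots,a_p\atop b_1,\dots,b_p}|q;z\big)=\sum_{k=0}^i\frac{(q^{-i},a_1,\dots,a_p;q)_k}{(q,b_1,\dots,b_p;q)_k}z^k$, $(b_1,\dots,b_p;q)_k=\prod_j(b_j;q)_k$ and $(b;q)_k=\prod_{\ell=0}^{k-1}(1-bq^\ell)$. Parameters are generic (all denominators non-zero) and the relations are for indices for which the functions involved are defined (terms with zero coefficient being omitted, e.g. those with $R_{-1}$).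
   Formalization: In (GI) with i=N, where the undefined R_N(x;...,N-1,z) has coefficient zero and is omitted, the relation is false for generic x (e.g. N=i=1, where the right side is 1); there it is stated only for x=0,...,N-1. *)

(* Defs.v *)
From HB Require Import structures.
From mathcomp Require Import all_boot all_order all_algebra.
From mathcomp Require Import reals sequences exp trigo.
From mathcomp Require Import complex.

Set Implicit Arguments.
Unset Strict Implicit.
Unset Printing Implicit Defensive.

Import Order.TTheory GRing.Theory Num.Theory.

Local Open Scope ring_scope.

Section BasicHypergeometric.
Variable F : fieldType.
Implicit Types (q b z : F) (s t : seq F).

(* (b; q)_k *)
Definition qpoch q b k : F := \prod_(l < k) (1 - b * q ^+ l).

(* (b_1, ..., b_p; q)_k for s = [:: b_1; ...; b_p] *)
Definition qpochs q s k : F := \prod_(b <- s) qpoch q b k.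

(* The terminating series phi(q^-i, s; t | q; z), where s and t list the
   parameters a_1, ..., a_p and b_1, ..., b_p. *)
Definition tphi q (i : nat) s t z : F :=
  \sum_(k < i.+1) qpochs q (q ^- i :: s) k / qpochs q (q :: t) k * z ^+ k.

(* All the denominators of tphi q i s t z are nonzero. *)
Definition tphi_defined q (i : nat) t : Prop :=
  forall k, (k <= i)%N -> qpochs q (q :: t) k != 0.

End BasicHypergeometric.

Section RG.
Variable R : realType.

(* exp (a + i b) = e^a (cos b + i sin b) *)
Definition cexp (w : R[i]) : R[i] :=
  Complex (expR (complex.Re w) * cos (complex.Im w))
          (expR (complex.Re w) * sin (complex.Im w)).

(* Complex powers q^x of q = cexp lq: lq is a determination of log q, which is
   kept as a parameter so that no branch is privileged. *)
Definition qpow (lq x : R[i]) : R[i] := cexp (x * lq).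

(* The functions R^(G)_i(x; alpha, beta, gamma, delta, N, z), with base
   q = cexp lq. *)
Definition RG (lq : R[i]) (i : nat) (x a b c d : R[i]) (N : nat) (z : R[i]) :
    R[i] :=
  let q := cexp lq in
  tphi q i [:: a * b * q ^+ i.+1; qpow lq (- x); c * qpow lq (x - N%:R)]
           [:: a * q; d; q ^- N] z.

(* The denominators of RG lq i x a b c d N z do not vanish; they depend neither
   on x, z nor on b, c. Since (q^-N; q)_k = 0 for k > N, this implies i <= N.
   It is inherited by smaller indices i. *)
Definition RG_defined (lq : R[i]) (i : nat) (a d : R[i]) (N : nat) : Prop :=
  let q := cexp lq in tphi_defined q i [:: a * q; d; q ^- N].

End RG.

(* Main.v *)
Require Import Defs.
From HB Require Import structures.
From mathcomp Require Import all_boot all_order all_algebra.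
From mathcomp Require Import reals sequences exp trigo.
From mathcomp Require Import complex ring.

Set Implicit Arguments.
Unset Strict Implicit.
Unset Printing Implicit Defensive.

Import Order.TTheory GRing.Theory Num.Theory.

Local Open Scope ring_scope.

(** Each of the six relations holds term by term, up to a shift of the summation
   index in the one for the difference [R_(i+1) - R_i].

   Write [m = a b] and let [w_k] be the part of the [k]-th term of [R_i] that
   does not depend on [i], so that
     [R_i = \sum_(k <= i) (q^-i; q)_k (m q^(i+1); q)_k w_k].
   Two identities of shifted factorials hold without any division:
     [(1 - y) (y q; q)_k = (1 - y q^k) (y; q)_k]                 and
     [(1 - q^i) (q^-(i-1); q)_k = (q^k - q^i) (q^-i; q)_k].
   Hence the functions of index [i] and [i - 1] with [m q] in place of [m] and
   with weights [w'], multiplied by [1 - m q^(i+1)] and [1 - q^i] respectively,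
   are sums over the same range [k <= i] with the same factor
   [(q^-i; q)_k (m q^(i+1); q)_k]. A relation between the three functions
   therefore follows from the identity
     [C w_k = (A (1 - m q^(i+1) q^k) + B (q^k - q^i)) w'_k]
   for [k <= i] ([qsum_contiguous]). When [N], [delta] or [alpha] is shifted,
   [w] and [w'] differ by a shift of one lower parameter [D], which is [q^-N],
   [delta] or [alpha q], so that [w_k / w'_k = (1 - D q^k) / (1 - D)]. When only
   [beta] is shifted, [w = w']; when [z] is replaced by [z / q] as well,
   [w_k / w'_k = q^k]. What remains is in each case a polynomial identity of
   degree at most one in [q^k].

   In that last relation, the difference of the [k]-th terms of [R_(i+1)] and
   [R_i] has the factor [(1 - q^k) (m q^(i+1) - q^-(i+1))]; the term [k = 0]
   drops out, and shifting [k] by one multiplies every parameter of the weight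
   other than [z] by [q] ([qsum_sub], [weight_succ]). *)

(** * Terminating sums over a field *)

Section BasicContiguity.
Variables (F : fieldType) (q : F).
Hypothesis q0 : q != 0.
Implicit Types (b u y z A B C D E X Y : F) (w : nat -> F).

Lemma qpoch0 b : qpoch q b 0 = 1.
Proof. by rewrite /qpoch big_ord0. Qed.

Lemma qpochS b k : qpoch q b k.+1 = qpoch q b k * (1 - b * q ^+ k).
Proof. by rewrite /qpoch big_ord_recr. Qed.

Lemma qpochSl b k : qpoch q b k.+1 = (1 - b) * qpoch q (b * q) k.
Proof.
rewrite /qpoch big_ord_recl expr0 mulr1; congr (_ * _).
by apply: eq_bigr => l _; rewrite lift0 exprS mulrA.
Qed.

Lemma qpoch_shift b k :
  (1 - b) * qpoch q (b * q) k = (1 - b * q ^+ k) * qpoch q b k.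
Proof. by rewrite -qpochSl qpochS mulrC. Qed.

Lemma qpochV_shift b k : qpoch q b k != 0 -> qpoch q (b * q) k != 0 ->
  (1 - b) / qpoch q b k = (1 - b * q ^+ k) / qpoch q (b * q) k.
Proof. by move=> b0 b1; apply/eqP; rewrite eqr_div// qpoch_shift. Qed.

Lemma qpoch_eq0 n k : (n < k)%N -> qpoch q (q ^- n) k = 0.
Proof.
move=> nk; rewrite /qpoch (bigD1 (Ordinal nk))//= mulVf ?subrr ?mul0r//.
exact: expf_neq0.
Qed.

(** At [i = 0] the index [i.-1] is 0 and both sides vanish, so that no case
   distinction is needed in the sums below. *)
Lemma qpoch_pred i k :
  (1 - q ^+ i) * qpoch q (q ^- i.-1) k = (q ^+ k - q ^+ i) * qpoch q (q ^- i) k.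
Proof.
case: i => [|i] /=.
  rewrite expr0 subrr mul0r invr1.
  case: k => [|k]; first by rewrite subrr mul0r.
  by rewrite qpochSl subrr mul0r mulr0.
have qi0 : q ^+ i != 0 by exact: expf_neq0.
have := qpoch_shift (q ^- i.+1) k.
have -> : q ^- i.+1 * q = q ^- i by rewrite exprS; field; rewrite q0 qi0.
move=> /(congr1 (fun t => - q ^+ i.+1 * t)); rewrite !mulrA.
have qS0 : q ^+ i.+1 != 0 by exact: expf_neq0.
rewrite !mulrBr !mulr1 !mulNr mulrA !divff// opprK addrC mul1r => ->.
by congr (_ * _); rewrite addrC opprK.
Qed.

(** The series with general term [(q^-i, m q^(i+1); q)_k w_k]; the weight [w]
   gathers the factors of a basic hypergeometric term that do not involve [i].
   The parameter [m] stands for the product [alpha beta]. *)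
Definition qsum i m w : F :=
  \sum_(k < i.+1) qpoch q (q ^- i) k * qpoch q (m * q ^+ i.+1) k * w k.

(** The sum of index [i.-1] extends to [k <= i], because [q^k - q^i] vanishes at
   [k = i]. *)
Lemma qsum_pred i m w : (1 - q ^+ i) * qsum i.-1 (m * q) w =
  \sum_(k < i.+1) (q ^+ k - q ^+ i) * qpoch q (q ^- i) k
                  * qpoch q (m * q ^+ i.+1) k * w k.
Proof.
rewrite big_ord_recr /= subrr !mul0r addr0.
case: i => [|i]; first by rewrite expr0 subrr mul0r big_ord0.
rewrite big_distrr; apply: eq_bigr => k _ /=.
by rewrite -qpoch_pred !mulrA -(mulrA m) -exprS.
Qed.

(** Contiguous relations reduce to an identity between the weights. *)
Lemma qsum_contiguous i m A B C w w' :
    (forall k, (k <= i)%N ->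
      C * w k =
      (A * (1 - m * q ^+ (i + 1) * q ^+ k) + B * (q ^+ k - q ^+ i)) * w' k) ->
  C * qsum i m w = A * (1 - m * q ^+ (i + 1)) * qsum i (m * q) w'
                   + B * (1 - q ^+ i) * qsum i.-1 (m * q) w'.
Proof.
rewrite addn1 => ww'.
rewrite -[B * _ * _]mulrA qsum_pred /qsum !big_distrr -big_split /=.
apply: eq_bigr => k _; rewrite (mulrAC m q).
have := ww' k (ltn_ord k); have := qpoch_shift (m * q ^+ i.+1) k.
move: (m * q ^+ i.+1) => y.
move: (qpoch q (q ^- i) k) (qpoch q (y * q) k) (qpoch q y k) => P Q S yE wE.
rewrite mulrCA wE.
transitivity (P * A * ((1 - y * q ^+ k) * S) * w' k
  + B * (q ^+ k - q ^+ i) * P * S * w' k); first by ring.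
by rewrite -yE; ring.
Qed.

(** The two upper parameters depending on [i] shift together; the bracket left
   over, [(1 - v) (1 - y Q) - (1 - v Q) (1 - y) = (y - v) (1 - Q)] with
   [v = q^-(i+1)], [y = m q^(i+1)], [Q = q^(k+1)], factors. *)
Lemma qsum_sub i m w : qsum i.+1 m w - qsum i m w =
  (m * q ^+ i.+1 - q ^- i.+1)
    * qsum i (m * q) (fun k => (1 - q ^+ k.+1) * w k.+1).
Proof.
(* the added term vanishes because [(q^-i; q)_(i+1) = 0] *)
have -> : qsum i m w =
    \sum_(k < i.+2) qpoch q (q ^- i) k * qpoch q (m * q ^+ i.+1) k * w k.
  by rewrite big_ord_recr /= (qpoch_eq0 (ltnSn i)) !mul0r addr0.
rewrite /qsum -sumrB big_ord_recl /= !qpoch0 subrr add0r big_distrr.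
apply: eq_bigr => k _; rewrite /bump /= add1n.
rewrite (exprSr q i.+1) (mulrAC m q) (mulrA m).
move: (m * q ^+ i.+1) => y.
rewrite (qpochSl (q ^- i.+1)) (qpochSl y) (qpochS (y * q)) (qpochS (q ^- i)).
have -> : q ^- i.+1 * q = q ^- i.
  by rewrite exprS; field; rewrite q0 expf_neq0.
have -> : q ^- i = q ^- i.+1 * q.
  by rewrite exprS; field; rewrite q0 expf_neq0.
by move: (q ^- i.+1) => v; rewrite exprS; ring.
Qed.

(** * Weights of 4phi3 series *)

(** Weight of a 4phi3 with upper parameters [X], [Y] and lower parameters
   [A], [D], [E]; the two remaining upper parameters are those of [qsum]. *)
Definition weight X Y A D E z k : F :=
  (qpoch q A k)^-1 * ((qpoch q D k)^-1 * ((qpoch q E k)^-1 *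
    (qpoch q X k * qpoch q Y k / qpoch q q k * z ^+ k))).

Lemma weightCA X Y A D E z k : weight X Y A D E z k = weight X Y D A E z k.
Proof. by rewrite /weight mulrCA. Qed.

Lemma weightAC X Y A D E z k : weight X Y A D E z k = weight X Y A E D z k.
Proof. by rewrite /weight; congr (_ * _); rewrite mulrCA. Qed.

Lemma tphiE i m X Y A D E z :
  tphi q i [:: m * q ^+ i.+1; X; Y] [:: A; D; E] z =
  qsum i m (weight X Y A D E z).
Proof.
apply: eq_bigr => k _; rewrite /qpochs !big_cons !big_nil !mulr1 /weight !invfM.
by ring.
Qed.

Lemma tphi_definedP i A D E : tphi_defined q i [:: A; D; E] ->
  forall k, (k <= i)%N -> [/\ qpoch q q k != 0, qpoch q A k != 0,
    qpoch q D k != 0 & qpoch q E k != 0].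
Proof.
move=> def k /def; rewrite /qpochs !big_cons big_nil mulr1 !mulf_eq0 !negb_or.
by case/and4P.
Qed.

Lemma weight_shiftA X Y A D E z k :
    qpoch q A k != 0 -> qpoch q (A * q) k != 0 ->
  (1 - A) * weight X Y A D E z k =
  (1 - A * q ^+ k) * weight X Y (A * q) D E z k.
Proof. by move=> A0 A1; rewrite /weight !mulrA qpochV_shift. Qed.

Lemma weight_shiftD X Y A D E z k :
    qpoch q D k != 0 -> qpoch q (D * q) k != 0 ->
  (1 - D) * weight X Y A D E z k =
  (1 - D * q ^+ k) * weight X Y A (D * q) E z k.
Proof. by move=> D0 D1; rewrite !(weightCA _ _ A); exact: weight_shiftA. Qed.

Lemma weight_shiftE X Y A D E z k :
    qpoch q E k != 0 -> qpoch q (E * q) k != 0 ->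
  (1 - E) * weight X Y A D E z k =
  (1 - E * q ^+ k) * weight X Y A D (E * q) z k.
Proof. by move=> E0 E1; rewrite !(weightAC _ _ _ D); exact: weight_shiftD. Qed.

Lemma weight_scale X Y A D E z k :
  weight X Y A D E z k = q ^+ k * weight X Y A D E (z / q) k.
Proof.
have zE : z ^+ k = q ^+ k * (z / q) ^+ k by rewrite -exprMn mulrCA divff ?mulr1.
by rewrite /weight zE; ring.
Qed.

Lemma weight_succ X Y A D E z k : qpoch q q k.+1 != 0 ->
  (1 - q ^+ k.+1) * weight X Y A D E z k.+1 =
  (1 - X) * (1 - Y) * z / ((1 - A) * (1 - D) * (1 - E))
    * weight (X * q) (Y * q) (A * q) (D * q) (E * q) z k.
Proof.
rewrite (qpochS q) -exprS mulf_eq0 => /norP[_ qk].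
rewrite /weight (qpochS q) -exprS !qpochSl (exprS z) !invfM.
move: (divff qk); move: (1 - q ^+ k.+1) => c cV.
rewrite -[RHS]mul1r -cV; ring.
Qed.

(** * Contiguous relations over a field *)

Lemma exprM2D1 i : q ^+ (2 * i + 1) = q ^+ (i + 1) * q ^+ i.
Proof. by rewrite -exprD addnAC addnn mul2n. Qed.

(** In the application [E = q^-N] and [Q = q^N], and [N] becomes [N - 1]. When
   [(E q; q)_k = 0], the weight on the right has a zero denominator; the
   relation survives if the [k]-th term vanishes on both sides on account of
   its numerator [(X; q)_k]. *)
Lemma qsum_shift_E i m X Y A D E Q z : E * Q = 1 -> 1 - Q != 0 ->
    1 - m * q ^+ (2 * i + 1) != 0 -> tphi_defined q i [:: A; D; E] ->
    (forall k, (k <= i)%N -> qpoch q (E * q) k != 0 \/ qpoch q X k = 0) ->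
  qsum i m (weight X Y A D E z) =
  (1 - m * q ^+ (i + 1)) * (q ^+ i - Q) / ((1 - Q) * (1 - m * q ^+ (2 * i + 1)))
    * qsum i (m * q) (weight X Y A D (E * q) z)
  + (1 - m * Q * q ^+ (i + 1)) * (1 - q ^+ i)
      / ((1 - Q) * (1 - m * q ^+ (2 * i + 1)))
    * qsum i.-1 (m * q) (weight X Y A D (E * q) z).
Proof.
move=> EQ Q1 yu /tphi_definedP def zero.
have QE : 1 - Q = - Q * (1 - E) by ring: EQ.
have C0 : (1 - Q) * (1 - m * q ^+ (2 * i + 1)) != 0 by exact: mulf_neq0.
apply: (mulfI C0).
rewrite (@qsum_contiguous i m (q ^+ i - Q) (1 - m * Q * q ^+ (i + 1)) _ _
           (weight X Y A D (E * q) z)).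
  by field; rewrite Q1 yu.
move=> k ki; have [_ _ _ Ek] := def k ki.
have [Eqk|Xk] := zero k ki; last by rewrite /weight Xk !(mul0r, mulr0).
have wE := weight_shiftE X Y A D z Ek Eqk.
transitivity (- Q * (1 - m * q ^+ (2 * i + 1))
                * ((1 - E) * weight X Y A D E z k)).
  by rewrite QE; ring.
rewrite wE exprM2D1; ring: EQ.
Qed.

Lemma qsum_shift_D i m X Y A D E z : 1 - D != 0 ->
    1 - m * q ^+ (2 * i + 1) != 0 -> tphi_defined q i [:: A; D; E] ->
    tphi_defined q i [:: A; D * q; E] ->
  qsum i m (weight X Y A D E z) =
  (1 - D * q ^+ i) * (1 - m * q ^+ (i + 1))
      / ((1 - D) * (1 - m * q ^+ (2 * i + 1)))
    * qsum i (m * q) (weight X Y A (D * q) E z)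
  - (1 - q ^+ i) * (D - m * q ^+ (i + 1))
      / ((1 - D) * (1 - m * q ^+ (2 * i + 1)))
    * qsum i.-1 (m * q) (weight X Y A (D * q) E z).
Proof.
move=> D1 yu /tphi_definedP def /tphi_definedP def'.
have C0 : (1 - D) * (1 - m * q ^+ (2 * i + 1)) != 0 by exact: mulf_neq0.
apply: (mulfI C0).
rewrite (@qsum_contiguous i m (1 - D * q ^+ i) (m * q ^+ (i + 1) - D) _ _
           (weight X Y A (D * q) E z)).
  by field; rewrite D1 yu.
move=> k ki; have [_ _ Dk _] := def k ki; have [_ _ Dqk _] := def' k ki.
by rewrite mulrAC (weight_shiftD X Y A E z Dk Dqk) exprM2D1; ring.
Qed.

Lemma qsum_shift_A i a b X Y D E z : 1 - a * q != 0 ->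
    1 - a * b * q ^+ (2 * i + 1) != 0 -> tphi_defined q i [:: a * q; D; E] ->
    tphi_defined q i [:: a * q * q; D; E] ->
  qsum i (a * b) (weight X Y (a * q) D E z) =
  (1 - a * q ^+ (i + 1)) * (1 - a * b * q ^+ (i + 1))
      / ((1 - a * q) * (1 - a * b * q ^+ (2 * i + 1)))
    * qsum i (a * b * q) (weight X Y (a * q * q) D E z)
  - a * q * (1 - b * q ^+ i) * (1 - q ^+ i)
      / ((1 - a * q) * (1 - a * b * q ^+ (2 * i + 1)))
    * qsum i.-1 (a * b * q) (weight X Y (a * q * q) D E z).
Proof.
move=> A1 yu /tphi_definedP def /tphi_definedP def'.
have C0 : (1 - a * q) * (1 - a * b * q ^+ (2 * i + 1)) != 0.
  exact: mulf_neq0.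
apply: (mulfI C0).
rewrite (@qsum_contiguous i (a * b) (1 - a * q ^+ (i + 1))
           (- (a * q * (1 - b * q ^+ i))) _ _ (weight X Y (a * q * q) D E z)).
  by field; rewrite A1 yu.
move=> k ki; have [_ Ak _ _] := def k ki; have [_ Aqk _ _] := def' k ki.
rewrite mulrAC (weight_shiftA X Y D E z Ak Aqk) exprM2D1 exprD expr1.
by ring.
Qed.

(** The weight is arbitrary here, since it is the same on both sides. *)
Lemma qsum_shift i m w : 1 - m * q ^+ (2 * i + 1) != 0 ->
  qsum i m w =
  (1 - m * q ^+ (i + 1)) / (1 - m * q ^+ (2 * i + 1)) * qsum i (m * q) w
  + m * q ^+ (i + 1) * (1 - q ^+ i) / (1 - m * q ^+ (2 * i + 1))
    * qsum i.-1 (m * q) w.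
Proof.
move=> yu; apply: (mulfI yu).
rewrite (@qsum_contiguous i m 1 (m * q ^+ (i + 1)) _ _ w); first by field.
by move=> k _; rewrite exprM2D1; ring.
Qed.

Lemma qsum_shift_z i m X Y A D E z : 1 - m * q ^+ (2 * i + 1) != 0 ->
  qsum i m (weight X Y A D E z) =
  q ^+ i * (1 - m * q ^+ (i + 1)) / (1 - m * q ^+ (2 * i + 1))
    * qsum i (m * q) (weight X Y A D E (z / q))
  + (1 - q ^+ i) / (1 - m * q ^+ (2 * i + 1))
    * qsum i.-1 (m * q) (weight X Y A D E (z / q)).
Proof.
move=> yu; apply: (mulfI yu).
rewrite (@qsum_contiguous i m (q ^+ i) 1 _ _ (weight X Y A D E (z / q))).
  by field.
by move=> k _; rewrite weight_scale exprM2D1; ring.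
Qed.

(** In the application, again, [E = q^-N] and [Q = q^N]. *)
Lemma qsum_weight_sub i m X Y A D E Q z : E * Q = 1 -> z != 0 ->
    1 - m * q ^+ (2 * i + 2) != 0 -> tphi_defined q i.+1 [:: A; D; E] ->
  (1 - X) * (1 - Y)
    * qsum i (m * q) (weight (X * q) (Y * q) (A * q) (D * q) (E * q) z) =
  E * q ^+ (i + 1) * (1 - A) * (1 - D) * (1 - Q)
      / (z * (1 - m * q ^+ (2 * i + 2)))
    * (qsum i.+1 m (weight X Y A D E z) - qsum i m (weight X Y A D E z)).
Proof.
move=> EQ z0 yu /tphi_definedP def; rewrite qsum_sub.
have -> : qsum i (m * q) (fun k => (1 - q ^+ k.+1) * weight X Y A D E z k.+1) =
    (1 - X) * (1 - Y) * z / ((1 - A) * (1 - D) * (1 - E))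
    * qsum i (m * q) (weight (X * q) (Y * q) (A * q) (D * q) (E * q) z).
  rewrite /qsum big_distrr; apply: eq_bigr => k _ /=.
  have [qk _ _ _] := def k.+1 (ltn_ord k).
  by rewrite weight_succ // mulrCA.
have [_ A1 D1 E1] := def 1%N isT.
move: A1 D1 E1; rewrite !qpochS !qpoch0 !mul1r !mulr1 => A1 D1 E1.
have v0 : q ^+ i.+1 != 0 by exact: expf_neq0.
have vE : q ^+ (2 * i + 2) = q ^+ i.+1 * q ^+ i.+1.
  by rewrite -exprD addnn doubleS addn2 mul2n.
have QE : E * (1 - Q) = - (1 - E) by ring: EQ.
rewrite addn1; move: yu; rewrite vE; move: (q ^+ i.+1) v0 => v v0 yu.
transitivity (- (1 - E) * v * (1 - A) * (1 - D) / (z * (1 - m * (v * v))) *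
  ((m * v - v^-1) * ((1 - X) * (1 - Y) * z / ((1 - A) * (1 - D) * (1 - E)) *
   qsum i (m * q) (weight (X * q) (Y * q) (A * q) (D * q) (E * q) z)))).
  by field; rewrite yu z0 v0 A1 D1 E1.
by rewrite -QE; ring.
Qed.

End BasicContiguity.

(** * Complex powers of the base *)

Section ComplexPowers.
Variable R : realType.
Implicit Types lq w x : R[i].

Lemma cexpD w1 w2 : cexp (w1 + w2) = cexp w1 * cexp w2.
Proof.
case: w1 w2 => [r1 s1] [r2 s2]; rewrite /cexp /= expRD cosD sinD.
by congr Complex; ring.
Qed.

Lemma cexp0 : cexp (0 : R[i]) = 1.
Proof. by rewrite /cexp /= expR0 cos0 sin0 mulr0 mulr1. Qed.

Lemma cexp_neq0 w : cexp w != 0.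
Proof.
apply/eqP => w0; have /eqP := cexpD w (- w).
by rewrite subrr cexp0 w0 mul0r oner_eq0.
Qed.

Lemma qpowD lq x y : qpow lq (x + y) = qpow lq x * qpow lq y.
Proof. by rewrite /qpow mulrDl cexpD. Qed.

Lemma qpow1 lq : qpow lq 1 = cexp lq.
Proof. by rewrite /qpow mul1r. Qed.

Lemma qpowN lq x : qpow lq (- x) = (qpow lq x)^-1.
Proof.
apply: (mulIf (cexp_neq0 (x * lq))).
by rewrite mulVf ?cexp_neq0// -/(qpow lq x) -qpowD addNr /qpow mul0r cexp0.
Qed.

Lemma qpow_nat lq n : qpow lq n%:R = cexp lq ^+ n.
Proof.
elim: n => [|n IHn]; first by rewrite /qpow mul0r cexp0.
by rewrite -natr1 qpowD IHn qpow1 exprSr.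
Qed.

End ComplexPowers.

(** * The functions R^(G) *)

Lemma RGE (R : realType) (lq : R[i]) i (x a b c d : R[i]) N (z : R[i]) :
  let q := cexp lq in
  RG lq i x a b c d N z =
  qsum q i (a * b)
    (weight q (qpow lq (- x)) (c * qpow lq (x - N%:R)) (a * q) d (q ^- N) z).
Proof. by rewrite /RG tphiE. Qed.

(* At i = 0 the index i.-1 stands for -1; the term has coefficient 0.
   In (GI) the first term of the right-hand side has coefficient 0 when i = N,
   and is then omitted; in that case the relation holds on the grid
   x = 0, ..., N - 1 but not for arbitrary x. *)
Theorem mainTheorem20 (R : realType) (lq q : R[i]) (hq : q = cexp lq)
    (i N : nat) (x a b c d z : R[i]) :
  (* GI *)
  ((0 < N)%N ->
   1 - q ^+ N != 0 -> 1 - a * b * q ^+ (2 * i + 1) != 0 ->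
   RG_defined lq i a d N ->
   RG_defined lq i a d (N - 1) \/
     (i = N /\ exists n : nat, (n < N)%N /\ x = n%:R) ->
   RG lq i x a b c d N z =
     (1 - a * b * q ^+ (i + 1)) * (q ^+ i - q ^+ N)
       / ((1 - q ^+ N) * (1 - a * b * q ^+ (2 * i + 1)))
       * RG lq i x a (b * q) (c / q) d (N - 1) z
     + (1 - a * b * q ^+ (N + i + 1)) * (1 - q ^+ i)
       / ((1 - q ^+ N) * (1 - a * b * q ^+ (2 * i + 1)))
       * RG lq i.-1 x a (b * q) (c / q) d (N - 1) z)
  /\
  (* GII *)
  (1 - d != 0 -> 1 - a * b * q ^+ (2 * i + 1) != 0 ->
   RG_defined lq i a d N -> RG_defined lq i a (d * q) N ->
   RG lq i x a b c d N z =
     (1 - d * q ^+ i) * (1 - a * b * q ^+ (i + 1))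
       / ((1 - d) * (1 - a * b * q ^+ (2 * i + 1)))
       * RG lq i x a (b * q) c (d * q) N z
     - (1 - q ^+ i) * (d - a * b * q ^+ (i + 1))
       / ((1 - d) * (1 - a * b * q ^+ (2 * i + 1)))
       * RG lq i.-1 x a (b * q) c (d * q) N z)
  /\
  (* GIII *)
  ((0 < N)%N ->
   z != 0 -> 1 - a * b * q ^+ (2 * i + 2) != 0 ->
   RG_defined lq i.+1 a d N -> RG_defined lq i (a * q) (d * q) (N - 1) ->
   (1 - qpow lq (- x)) * (1 - c * qpow lq (x - N%:R))
     * RG lq i (x - 1) (a * q) b (c * q) (d * q) (N - 1) z =
   q ^ (i%:Z - N%:Z + 1) * (1 - a * q) * (1 - d) * (1 - q ^+ N)
     / (z * (1 - a * b * q ^+ (2 * i + 2)))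
     * (RG lq i.+1 x a b c d N z - RG lq i x a b c d N z))
  /\
  (* GIV *)
  (1 - a * q != 0 -> 1 - a * b * q ^+ (2 * i + 1) != 0 ->
   RG_defined lq i a d N -> RG_defined lq i (a * q) d N ->
   RG lq i x a b c d N z =
     (1 - a * q ^+ (i + 1)) * (1 - a * b * q ^+ (i + 1))
       / ((1 - a * q) * (1 - a * b * q ^+ (2 * i + 1)))
       * RG lq i x (a * q) b c d N z
     - a * q * (1 - b * q ^+ i) * (1 - q ^+ i)
       / ((1 - a * q) * (1 - a * b * q ^+ (2 * i + 1)))
       * RG lq i.-1 x (a * q) b c d N z)
  /\
  (* GV *)
  (1 - a * b * q ^+ (2 * i + 1) != 0 ->
   RG_defined lq i a d N ->
   RG lq i x a b c d N z =
     (1 - a * b * q ^+ (i + 1)) / (1 - a * b * q ^+ (2 * i + 1))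
       * RG lq i x a (b * q) c d N z
     + a * b * q ^+ (i + 1) * (1 - q ^+ i) / (1 - a * b * q ^+ (2 * i + 1))
       * RG lq i.-1 x a (b * q) c d N z)
  /\
  (* GVI *)
  (1 - a * b * q ^+ (2 * i + 1) != 0 ->
   RG_defined lq i a d N ->
   RG lq i x a b c d N z =
     q ^+ i * (1 - a * b * q ^+ (i + 1)) / (1 - a * b * q ^+ (2 * i + 1))
       * RG lq i x a (b * q) c d N (z / q)
     + (1 - q ^+ i) / (1 - a * b * q ^+ (2 * i + 1))
       * RG lq i.-1 x a (b * q) c d N (z / q)).
Proof.
have q0 : q != 0 by rewrite hq cexp_neq0.
have EQ : q ^- N * q ^+ N = 1 by rewrite mulVf ?expf_neq0.
have Eq : (0 < N)%N -> q ^- (N - 1) = q ^- N * q.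
  move=> N0; have -> : q ^+ N = q ^+ (N - 1) * q.
    by rewrite -exprSr subn1 prednK.
  by rewrite invfM mulfVK.
rewrite /RG_defined !RGE -hq.
split; [|split; [|split; [|split; [|split]]]].
- move=> N0 qN yu def zero.
  have cE : c / q * qpow lq (x - (N - 1)%:R) = c * qpow lq (x - N%:R).
    have -> : x - (N - 1)%:R = 1 + (x - N%:R) by rewrite natrB //; ring.
    by rewrite (qpowD _ 1) qpow1 -hq mulrA mulfVK.
  have abE : a * b * q ^+ (N + i + 1) = a * b * q ^+ N * q ^+ (i + 1).
    by rewrite -addnA exprD mulrA.
  rewrite cE Eq // abE (mulrA a b q).
  apply: qsum_shift_E => // k ki; case: zero => [def'|[iN [n [nN xn]]]].
    by left; rewrite -Eq //; case: (tphi_definedP def' ki).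
  (* for i = N and x = n < N: the term k = N contains (q^-n; q)_N = 0 *)
  move: ki; rewrite leq_eqVlt => /orP[/eqP ->|ki]; [right|left].
    by rewrite xn qpowN qpow_nat -hq qpoch_eq0 // iN.
  have [_ _ _] := tphi_definedP def ki.
  by rewrite qpochSl mulf_eq0 => /norP[].
- by move=> d1 yu def def'; rewrite (mulrA a b q); exact: qsum_shift_D.
- move=> N0 z0 yu def def'; rewrite Eq //.
  have -> : qpow lq (- (x - 1)) = qpow lq (- x) * q.
    by rewrite opprB addrC qpowD qpow1 -hq.
  have -> : c * q * qpow lq (x - 1 - (N - 1)%:R) = c * qpow lq (x - N%:R) * q.
    have -> : x - 1 - (N - 1)%:R = x - N%:R by rewrite natrB //; ring.
    by rewrite mulrAC.
  have -> : q ^ (i%:Z - N%:Z + 1) = q ^- N * q ^+ (i + 1).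
    by rewrite addrAC expfzDr // -exprnN mulrC.
  by rewrite (mulrAC a q b); exact: qsum_weight_sub.
- by move=> a1 yu def def'; rewrite (mulrAC a q b); exact: qsum_shift_A.
- by move=> yu _; rewrite (mulrA a b q); exact: qsum_shift.
- by move=> yu _; rewrite (mulrA a b q); exact: qsum_shift_z.
Qed.
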